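(* For all integers $d\ge 3$ and $n\ge d+3$, \[ \mathsf{M}_d(n)\ \ge\ \binom{n-1}{d}+\binom{n-4}{d-2}+\binom{n-6}{d-3}. \]
   Context: For a finite set $X$ and an integer $r\ge 0$, $\binom{X}{r}=\{A\subseteq X: |A|=r\}$; $[n]=\{1,\dots,n\}$. For a family $\mathcal F\subseteq 2^X$ and $S\subseteq X$, the trace of $\mathcal F$ on $S$ is $\mathcal F\!\upharpoonright_S=\{F\cap S: F\in\mathcal F\}$. The set $S$ is shattered by $\mathcal F$ if $\mathcal F\!\upharpoonright_S=2^S$, and the VC-dimension $\operatorname{VC}(\mathcal F)$ is the maximum cardinality of a set shattered by $\mathcal F$. For integers $d\ge 0$ and $n\ge d+1$, define \[ \mathsf{M}_d(n)=\max\left\{|\mathcal F| : \mathcal F\subseteq\binom{[n]}{d+1},\ \operatorname{VC}(\mathcal F)\le d\right\}. \] *)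

(* Defs.v *)
From mathcomp Require Import all_boot.

Set Implicit Arguments.
Unset Strict Implicit.
Unset Printing Implicit Defensive.

Definition trace (T : finType) (F : {set {set T}}) (S : {set T}) :
  {set {set T}} := [set A :&: S | A in F].

Definition shattered (T : finType) (F : {set {set T}}) (S : {set T}) : bool :=
  trace F S == powerset S.

(* The empty family shatters no set; its VC-dimension, a maximum over the
   empty set, is 0 here.  A nonempty family always shatters set0. *)
Definition VC (T : finType) (F : {set {set T}}) : nat :=
  \max_(S : {set T} | shattered F S) #|S|.

Definition uniform_family (T : finType) (r : nat) : {set {set T}} :=
  [set A : {set T} | #|A| == r].

(* The ground set [n] = {1, ..., n} is represented by 'I_n = {0, ..., n-1}.
   The maximum ranges over a nonempty collection: the empty family qualifies. *)
Definition M (d n : nat) : nat :=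
  \max_(F : {set {set 'I_n}}
         | (F \subset uniform_family 'I_n d.+1) && (VC F <= d)) #|F|.

(* Main.v *)
Require Import Defs.
From mathcomp Require Import all_boot zify.

Set Implicit Arguments.
Unset Strict Implicit.
Unset Printing Implicit Defensive.

(** Fix a core [C] of six points and let [F] consist of the [(d+1)]-sets whose
    trace on [C] belongs to a fixed list of patterns.  Two facts make such a
    family useful.

    - Non-shattering is a finite condition on the patterns
      ([VC_core_family]).  A [(d+1)]-set shattered by [F] must itself be a
      member [A] of [F].  If [A] has pattern [a], look only at members [G] that
      contain [A :\: C]: by equality of sizes, the pattern of such a [G] is not
      larger than [a].  So it is enough that some [b \subset a], the witness of
      [a], differs from [p :&: a] for every pattern [p] with [#|p| <= #|a|];
      then no member meets [A] in [b :|: (A :\: C)].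

    - The size of [F] depends only on how many patterns there are of each
      cardinality ([card_core_family]): each pattern of size [j] contributes
      ['C(n - 6, d + 1 - j)], or nothing if [j > d + 1].  Iterating Pascal's
      rule, the target ['C(n-1, d) + 'C(n-4, d-2) + 'C(n-6, d-3)] is the
      contribution of 1, 5, 11, 13, 6, 1 patterns of sizes 1, 2, 3, 4, 5, 6.

    It remains to exhibit 37 patterns with these sizes, each with a witness.
    With the core written 0, ..., 5, they arise from the star of 0, in which the
    empty set is a witness for everything and which accounts for ['C(n-1, d)].
    Five patterns are deleted from the star, namely 05, 024, 025, 045 and 0124,
    and ten patterns avoiding 0 are added: 35 together with any subset of 124,
    and the two patterns 234 and 1234.  The net gain is 1, 3, 1 patterns of sizes
    3, 4, 5, which contribute exactly ['C(n-4, d-2) + 'C(n-6, d-3)].  If an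
    added pattern is disjoint from a star pattern, the larger of the two, or
    both when the sizes agree, can no longer use the empty witness; the
    deletions make room for nonempty ones.  That they suffice is a finite
    verification ([pattern_witness]). *)

(** * Families determined by their trace on a core *)

(** The number of [k]-sets with a prescribed trace of size [j] on a core whose
    complement has [m] points.  The test is needed because subtraction is
    truncated: patterns larger than [k] must contribute nothing. *)
Definition extensions (m k j : nat) : nat :=
  if j <= k then 'C(m, k - j) else 0.

(** Pascal's rule: one point of the complement is moved into the core. *)
Lemma extensionsS m k j :
  extensions m.+1 k j = extensions m k j + extensions m k j.+1.
Proof.
rewrite /extensions; case: (ltngtP j k) => [lt_jk|//|->].
  by rewrite -(subnSK lt_jk) binS addnC.
by rewrite subnn !bin0.
Qed.

Section CoreFamily.

Variables (T : finType) (C : {set T}) (Q : {set {set T}}).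

Definition core_family (k : nat) : {set {set T}} :=
  [set A : {set T} | (#|A| == k) && (A :&: C \in Q)].

(** The sets counted are [p :|: D] with [D] disjoint from [C]. *)
Lemma card_core_fiber (p : {set T}) k : p \subset C ->
  #|[set A : {set T} | (#|A| == k) && (A :&: C == p)]|
    = extensions #|~: C| k #|p|.
Proof.
move=> sub_pC; rewrite /extensions; case: leqP => [le_pk|lt_kp]; last first.
  apply/eqP; rewrite cards_eq0; apply/eqP/setP=> A; rewrite !inE.
  apply/negP=> /andP[/eqP cardA /eqP defp].
  by move: lt_kp; rewrite -cardA -defp ltnNge subset_leq_card ?subsetIl.
rewrite -cards_draws.
have disjP (D : {set T}) : D \subset ~: C -> D :&: C = set0.
  by rewrite -disjoints_subset => /disjoint_setI0.
rewrite -[RHS](card_in_imset (f := fun D => p :|: D)); last first.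
  move=> D E; rewrite !inE => /andP[sD _] /andP[sE _] /setP eqDE.
  apply/setP=> x; have := eqDE x; rewrite !inE.
  have [xp|//] := boolP (x \in p).
  have xC := subsetP sub_pC _ xp.
  have out (U : {set T}) : U \subset ~: C -> x \in U = false.
    by move/subsetP=> sU; apply/negP=> /sU; rewrite inE xC.
  by rewrite !out.
apply: eq_card => A; rewrite inE; apply/andP/imsetP.
  case=> /eqP cardA /eqP defp; exists (A :\: C).
    by rewrite inE subsetDr /= -defp -cardA -(cardsID C A) addKn.
  by rewrite -defp setID.
case=> D; rewrite inE => /andP[sD /eqP cardD] ->.
have DC0 := disjP _ sD.
split; last by rewrite setIUl DC0 setU0 (setIidPl sub_pC).
have pD0 : p :&: D = set0.
  by apply/eqP; rewrite -subset0 -DC0 setIC setIS.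
by rewrite cardsU pD0 cards0 subn0 cardD subnKC.
Qed.

Lemma card_core_family k : Q \subset powerset C ->
  #|core_family k| = \sum_(p in Q) extensions #|~: C| k #|p|.
Proof.
move=> sQC; rewrite -sum1_card (partition_big (fun A => A :&: C) [in Q]).
  apply: eq_bigr => p Qp.
  have pC : p \subset C by have := subsetP sQC _ Qp; rewrite powersetE.
  rewrite -(card_core_fiber k pC) -sum1_card; apply: eq_bigl => A; rewrite !inE.
  by case: (A :&: C =P p) => [->|_]; rewrite ?[_ \in Q]Qp ?andbT ?andbF.
by move=> A; rewrite inE => /andP[].
Qed.

(** A shattered set of size [k.+1] is a member [A], and the subset of [A] missed
    by all the traces is the witness of its pattern together with the whole of
    [A :\: C]; taking all of [A :\: C] is what bounds the sizes of the patterns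
    against which the witness has to be tested. *)
Lemma VC_core_family k :
  (forall a, a \in Q -> exists2 b : {set T}, b \subset a &
     forall p, p \in Q -> #|p| <= #|a| -> p :&: a != b) ->
  VC (core_family k.+1) <= k.
Proof.
move=> witness; apply/bigmax_leqP => S /eqP shatS.
have getG (B : {set T}) : B \subset S ->
    exists2 G, G \in core_family k.+1 & B = G :&: S.
  by rewrite -powersetE -shatS => /imsetP.
have [A FA defS] := getG _ (subxx S).
have sSA : S \subset A by rewrite defS subsetIl.
move: (FA); rewrite inE => /andP[/eqP cardA QA].
rewrite leqNgt; apply/negP=> lt_kS.
have eqSA : S = A by apply/eqP; rewrite eqEcard sSA cardA.
have [b sba nob] := witness _ QA.
have sbA : b \subset A by rewrite (subset_trans sba) ?subsetIl.
have [|G] := getG (b :|: (A :\: C)); first by rewrite eqSA subUset sbA subsetDl.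
rewrite inE eqSA => /andP[/eqP cardG QG] defB.
have le_pattern : #|G :&: C| <= #|A :&: C|.
  have sAG : A :\: C \subset G :\: C.
    apply/subsetP=> x; rewrite !inE => /andP[xC xA]; rewrite xC /=.
    by have /setP/(_ x) := defB; rewrite !inE xC xA orbT andbT => <-.
  rewrite -(leq_add2r #|A :\: C|) cardsID cardA -cardG -(cardsID C G) leq_add2l.
  exact: subset_leq_card.
case/negP: (nob _ QG le_pattern); apply/eqP/setP=> x.
have /setP/(_ x) := defB; have /subsetP/(_ x) := sba; rewrite !inE.
case: (x \in b); case: (x \in C); case: (x \in A); case: (x \in G) => //= H //.
all: by have := H isT.
Qed.

End CoreFamily.

(** * The pattern table *)

(** Subsets of the core [{0, ..., 5}] as increasing lists; each pattern is paired
    with its witness. *)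
Definition pattern_table : seq (seq nat * seq nat) := [::
  ([:: 0], [::]);
  ([:: 0; 1], [:: 1]);
  ([:: 0; 2], [:: 2]);
  ([:: 0; 3], [::]);
  ([:: 0; 4], [:: 4]);
  ([:: 3; 5], [:: 5]);
  ([:: 0; 1; 2], [:: 1; 2]);
  ([:: 0; 1; 3], [::]);
  ([:: 0; 2; 3], [::]);
  ([:: 0; 1; 4], [:: 1; 4]);
  ([:: 0; 3; 4], [::]);
  ([:: 2; 3; 4], [:: 2; 4]);
  ([:: 0; 1; 5], [:: 1]);
  ([:: 0; 3; 5], [::]);
  ([:: 1; 3; 5], [:: 5]);
  ([:: 2; 3; 5], [:: 2; 5]);
  ([:: 3; 4; 5], [:: 4; 5]);
  ([:: 0; 1; 2; 3], [::]);
  ([:: 0; 1; 3; 4], [::]);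
  ([:: 0; 2; 3; 4], [::]);
  ([:: 1; 2; 3; 4], [:: 1; 2; 4]);
  ([:: 0; 1; 2; 5], [::]);
  ([:: 0; 1; 3; 5], [::]);
  ([:: 0; 2; 3; 5], [::]);
  ([:: 1; 2; 3; 5], [:: 5]);
  ([:: 0; 1; 4; 5], [::]);
  ([:: 0; 2; 4; 5], [::]);
  ([:: 0; 3; 4; 5], [::]);
  ([:: 1; 3; 4; 5], [:: 5]);
  ([:: 2; 3; 4; 5], [:: 2; 4]);
  ([:: 0; 1; 2; 3; 4], [::]);
  ([:: 0; 1; 2; 3; 5], [::]);
  ([:: 0; 1; 2; 4; 5], [::]);
  ([:: 0; 1; 3; 4; 5], [::]);
  ([:: 0; 2; 3; 4; 5], [::]);
  ([:: 1; 2; 3; 4; 5], [:: 5]);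
  ([:: 0; 1; 2; 3; 4; 5], [::])].

Definition patterns : seq (seq nat) := unzip1 pattern_table.

Lemma patterns_in_core p :
  p \in patterns -> uniq p && all (fun i => i < 6) p.
Proof. by move: p; apply/allP; vm_compute. Qed.

(** Stronger than being distinct as lists: this form survives the passage from
    lists to sets. *)
Definition separated (p q : seq nat) : bool :=
  has (fun i => (i \in p) != (i \in q)) (iota 0 6).

Lemma patterns_separated p q :
  p \in patterns -> q \in patterns -> p != q -> separated p q.
Proof.
move=> Pp Pq; apply/implyP.
have /allP/(_ p Pp)/allP/(_ q Pq) //: all (fun p => all (fun q =>
  (p != q) ==> separated p q) patterns) patterns.
by vm_compute.
Qed.

Lemma pattern_witness a : a \in patterns -> exists2 b, {subset b <= a} &
  forall p, p \in patterns -> size p <= size a ->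
    separated [seq i <- p | i \in a] b.
Proof.
have tableP : all (fun ab => all (mem ab.1) ab.2 && all (fun p =>
    (size p <= size ab.1) ==> separated [seq i <- p | i \in ab.1] ab.2)
    patterns) pattern_table by vm_compute.
case/mapP=> -[a' b] /(allP tableP)/andP[/allP sba /allP sep] ->.
by exists b => // p Pp; apply/implyP/sep.
Qed.

(** * The family on the ground set *)

Section GroundSet.

Variable m : nat.

Definition points (p : seq nat) : {set 'I_m.+4.+2} := [set x | val x \in p].

Lemma card_points p : uniq p && all (fun i => i < 6) p -> #|points p| = size p.
Proof.
case/andP=> uniq_p /allP p_lt6.
have p_lt i : i \in p -> i < m.+4.+2 by move/p_lt6=> /leq_trans; apply.
have uniq_ip : uniq [seq inord i : 'I_m.+4.+2 | i <- p].
  rewrite map_inj_in_uniq // => i j /p_lt lt_i /p_lt lt_j /(congr1 val).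
  by rewrite /= !inordK.
rewrite -(size_map (fun i => inord i : 'I_m.+4.+2)) -(card_uniqP uniq_ip).
apply: eq_card => x; rewrite inE; apply/idP/mapP => [px|[i p_i ->]].
  by exists (val x) => //; rewrite inord_val.
by rewrite /= inordK ?p_lt.
Qed.

Lemma separated_points p q : separated p q -> points p != points q.
Proof.
case/hasP=> i; rewrite mem_iota /= => lt_i6; apply: contra => /eqP/setP.
have lt_i : i < m.+4.+2 by rewrite (leq_trans lt_i6).
by move/(_ (Ordinal lt_i)); rewrite !inE /= => ->.
Qed.

Let core : {set 'I_m.+4.+2} := points (iota 0 6).
Let pattern_sets : {set {set 'I_m.+4.+2}} := [set P in map points patterns].

Let card_coreC : #|~: core| = m.
Proof. by rewrite cardsCs setCK card_points // card_ord !subSS subn0. Qed.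

Let pattern_sets_core : pattern_sets \subset powerset core.
Proof.
apply/subsetP=> P; rewrite inE powersetE => /mapP[p /patterns_in_core].
case/andP=> _ /allP p_lt6 ->; apply/subsetP=> x.
rewrite [x \in core]inE mem_iota inE; exact: p_lt6.
Qed.

Lemma VC_pattern_family d : VC (core_family core pattern_sets d.+1) <= d.
Proof.
apply: VC_core_family => A; rewrite inE => /mapP[a Pa ->].
have [b sba sep] := pattern_witness Pa; exists (points b).
  by apply/subsetP=> x; rewrite !inE => /sba.
move=> B; rewrite inE => /mapP[p Pp ->].
rewrite !card_points ?patterns_in_core // => /(sep _ Pp)/separated_points.
by congr (_ != _); apply/setP=> x; rewrite !inE mem_filter andbC.
Qed.

(** The sum over the patterns is a sum over their sizes, which is then folded by
    Pascal's rule: the right-hand side counts the [k]-sets with one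
    prescribed trace on cores of 1, 4 and 6 points. *)
Lemma card_pattern_family k :
  #|core_family core pattern_sets k|
    = extensions m.+4.+1 k 1 + extensions m.+2 k 3 + extensions m k 4.
Proof.
rewrite card_core_family ?pattern_sets_core // card_coreC.
have uniq_sets : uniq (map points patterns).
  rewrite map_inj_in_uniq; first by vm_compute.
  move=> p q Pp Pq /eqP eq_pq; apply/eqP; apply: contraLR eq_pq => ne_pq.
  exact/separated_points/patterns_separated.
rewrite (eq_bigl (mem (map points patterns))); last by move=> P; rewrite inE.
rewrite -big_uniq // big_map.
rewrite (eq_big_seq (fun p => extensions m k (size p))); last first.
  by move=> p /patterns_in_core /card_points->.
rewrite -(big_map size xpredT (extensions m k)) !extensionsS.
have ->: map size patterns = [:: 1] ++ nseq 5 2 ++ nseq 11 3 ++ nseq 13 4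
                          ++ nseq 6 5 ++ [:: 6] by vm_compute.
rewrite !big_cat !big_nseq !big_seq1 !iter_addn_0 /=.
lia.
Qed.

End GroundSet.

Theorem corollary1p2 (d n : nat) (hd : 3 <= d) (hn : d + 3 <= n) :
  'C(n - 1, d) + 'C(n - 4, d - 2) + 'C(n - 6, d - 3) <= M d n.
Proof.
have [m ->] : exists m, n = m.+4.+2.
  by exists (n - 6); lia.
have := card_pattern_family m d.+1.
rewrite /extensions !ltnS (leq_trans _ hd) // (leq_trans _ hd) // hd.
rewrite !subSS !subn0 => <-.
rewrite /M; apply: (leq_bigmax_cond (F := fun F : {set {set _}} => #|F|)).
rewrite VC_pattern_family andbT; apply/subsetP=> A.
by rewrite !inE => /andP[].
Qed.
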